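(* Up to isomorphism of hyperfields, there are exactly seven hyperfields of order $4$.
   Context: A hyperoperation on a set $S$ is a map $\boxplus: S\times S\to 2^S\setminus\{\varnothing\}$; for non-empty $A,B\subseteq S$ put $A\boxplus B=\bigcup_{a\in A,b\in B}(a\boxplus b)$ (singletons are identified with their elements). It is commutative if $a\boxplus b=b\boxplus a$, and associative if $a\boxplus(b\boxplus c)=(a\boxplus b)\boxplus c$ for all $a,b,c$. All hyperoperations are assumed commutative. A hypergroup $(G,\boxplus,0)$ is a set with an associative hyperoperation such that: (1) $0\boxplus x=\{x\}$ for all $x$; (2) for every $x$ there is a unique element $-x$ with $0\in x\boxplus(-x)$; (3) $x\in y\boxplus z$ if and only if $z\in x\boxplus(-y)$. A hyperring is a tuple $(R,\odot,\boxplus,1,0)$ such that $(R,\odot,1)$ is a commutative monoid, $(R,\boxplus,0)$ is a commutative hypergroup, $0\odot x=x\odot 0=0$ for all $x$, and $a\odot(x\boxplus y)=(a\odot x)\boxplus(a\odot y)$ and $(x\boxplus y)\odot a=(x\odot a)\boxplus(y\odot a)$ for all $a,x,y$ (where $a\odot A=\{a\odot s: s\in A\}$, and similarly for $A\odot a$). A hyperfield is a hyperring with $0\ne1$ in which every nonzero element has a multiplicative inverse. The order of a finite hyperfield is the cardinality of its underlying set. A homomorphism of hyperfields $f:\mathbb{F}\to\mathbb{L}$ is a map with $f(0)=0$, $f(1)=1$, $f(xy)=f(x)f(y)$ and $f(x\boxplus_{\mathbb{F}}y)\subseteq f(x)\boxplus_{\mathbb{L}}f(y)$ for all $x,y$.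 An isomorphism is a homomorphism having a two-sided inverse that is also a homomorphism. *)

(* Defs.v *)
From mathcomp Require Import all_boot.
From mathcomp Require Import boolp classical_sets functions cardinality.

Set Implicit Arguments.
Unset Strict Implicit.
Unset Printing Implicit Defensive.

Local Open Scope classical_set_scope.

Definition hyperadd (T : Type) (add : T -> T -> set T) (A B : set T) : set T :=
  \bigcup_(a in A) \bigcup_(b in B) add a b.

Record is_hyperoperation (T : Type) (add : T -> T -> set T) : Prop := {
  hyperop_neq0 : forall x y, add x y !=set0;
  hyperop_comm : commutative add
}.

(* The opposite of y is the unique y' with 0 in y [+] y'; the reversibility
   axiom quantifies over that y' instead of carrying - as an operation. *)
Record is_hypergroup (T : Type) (add : T -> T -> set T) (zero : T) : Prop := {
  hypergroup_hyperop : is_hyperoperation add;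
  hypergroup_assoc : forall a b c,
    hyperadd add [set a] (add b c) = hyperadd add (add a b) [set c];
  hypergroup_add0 : forall x, add zero x = [set x];
  hypergroup_opp : forall x, exists! y, add x y zero;
  hypergroup_rev : forall x y z y', add y y' zero ->
    (add y z x <-> add x y' z)
}.

Record is_hyperring (T : Type) (mul : T -> T -> T) (add : T -> T -> set T)
    (one zero : T) : Prop := {
  hyperring_mulA : associative mul;
  hyperring_mulC : commutative mul;
  hyperring_mul1 : left_id one mul;
  hyperring_hypergroup : is_hypergroup add zero;
  hyperring_mul0l : left_zero zero mul;
  hyperring_mul0r : right_zero zero mul;
  hyperring_distrl : forall a x y,
    mul a @` add x y = add (mul a x) (mul a y);
  hyperring_distrr : forall a x y,
    mul^~ a @` add x y = add (mul x a) (mul y a)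
}.

Record hyperfield : Type := Hyperfield {
  hf_sort :> Type;
  hf_mul : hf_sort -> hf_sort -> hf_sort;
  hf_add : hf_sort -> hf_sort -> set hf_sort;
  hf_one : hf_sort;
  hf_zero : hf_sort;
  hf_hyperring : is_hyperring hf_mul hf_add hf_one hf_zero;
  hf_zero_neq_one : hf_zero <> hf_one;
  hf_inv : forall x, x <> hf_zero -> exists y, hf_mul x y = hf_one
}.

Arguments hf_one : clear implicits.
Arguments hf_zero : clear implicits.

Definition has_order (F : hyperfield) (n : nat) : Prop :=
  ([set: F] #= `I_n)%card.

Record hyperfield_hom (F L : hyperfield) (f : F -> L) : Prop := {
  hom_zero : f (hf_zero F) = hf_zero L;
  hom_one : f (hf_one F) = hf_one L;
  hom_mul : forall x y, f (hf_mul x y) = hf_mul (f x) (f y);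
  hom_add : forall x y, f @` hf_add x y `<=` hf_add (f x) (f y)
}.

Definition hyperfield_isomorphic (F L : hyperfield) : Prop :=
  exists (f : F -> L) (g : L -> F),
    [/\ hyperfield_hom f, hyperfield_hom g, cancel f g & cancel g f].

(* Main.v *)
Require Import Defs.
From mathcomp Require Import all_boot.
From mathcomp Require Import boolp classical_sets functions cardinality.

(** The nonzero elements form a cyclic group of order 3, so we label the
    hyperfield by the field with four elements [0, 1, w, w^2], keeping its
    multiplication.  Since -1 squares to 1, it equals 1; hence the relation
    [z \in x [+] y] is symmetric in [x, y, z], and by distributivity it is
    invariant under simultaneous scaling.  It is therefore determined by four
    booleans, one for each orbit of nonzero triples: those of [(1, 1, 1)],
    [(1, 1, w)], [(1, 1, w^2)] and [(1, w, w^2)].  Of the 16 resulting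
    hyperadditions, nine are associative with nonempty sums; the only
    remaining freedom of labelling, the exchange of [w] and [w^2], swaps two
    pairs among them and fixes the other five, which leaves seven classes. *)

Set Implicit Arguments.
Unset Strict Implicit.
Unset Printing Implicit Defensive.

Local Open Scope classical_set_scope.

(** * Hypersums with a singleton *)

Lemma hyperadd_set1l (T : Type) (add : T -> T -> set T) a (B : set T) t :
  hyperadd add [set a] B t <-> exists2 u, B u & add a u t.
Proof.
split=> [[_ -> [u Bu ut]]|[u Bu ut]]; first by exists u.
by exists a => //; exists u.
Qed.

Lemma hyperadd_set1r (T : Type) (add : T -> T -> set T) c (A : set T) t :
  hyperadd add A [set c] t <-> exists2 u, A u & add u c t.
Proof.
split=> [[u Au [_ -> ut]]|[u Au ut]]; first by exists u.
by exists u => //; exists c.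
Qed.

(** * The field with four elements *)

(* The field F_2[w] with w^2 = w + 1; the pair (a, b) stands for a + b w. *)
Definition quad : Type := (bool * bool)%type.
Definition qzero : quad := (false, false).
Definition qone : quad := (true, false).
Definition omega : quad := (false, true).
Definition omega2 : quad := (true, true).
Definition quads : seq quad := [:: qzero; qone; omega; omega2].

Definition qadd (x y : quad) : quad := (x.1 (+) y.1, x.2 (+) y.2).
Definition qmul (x y : quad) : quad :=
  ((x.1 && y.1) (+) (x.2 && y.2),
   (x.1 && y.2) (+) (x.2 && y.1) (+) (x.2 && y.2)).
(** The nontrivial field automorphism: it exchanges [omega] and [omega2]. *)
Definition frob (x : quad) : quad := qmul x x.

Lemma mem_quads x : x \in quads.
Proof. by case: x => [[] []]. Qed.

Lemma qmulA : associative qmul.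
Proof. by move=> [[] []] [[] []] [[] []]. Qed.

Lemma qmulC : commutative qmul.
Proof. by move=> [[] []] [[] []]. Qed.

Lemma qmul1 : left_id qone qmul.
Proof. by move=> [[] []]. Qed.

(* Nonzero elements have order dividing 3, so squaring inverts them. *)
Lemma qmul_frobK a x : a != qzero -> qmul a (qmul (frob a) x) = x.
Proof. by case: a x => [[] []] [[] []]. Qed.

Lemma frobK : involutive frob.
Proof. by move=> [[] []]. Qed.

Lemma frobM x y : frob (qmul x y) = qmul (frob x) (frob y).
Proof. by case: x y => [[] []] [[] []]. Qed.

(** * Hyperadditions encoded by four booleans *)

(* The coordinates tell whether 0 lies in 1 + 1 + 1, 1 + 1 + w, 1 + 1 + w^2
   and 1 + w + w^2 respectively. *)
Definition weights : Type := (bool * bool * bool * bool)%type.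
Definition w111 (p : weights) := p.1.1.1.
Definition w11a (p : weights) := p.1.1.2.
Definition w11b (p : weights) := p.1.2.
Definition w1ab (p : weights) := p.2.

(** The action of [frob] on the four orbits of nonzero triples. *)
Definition swap (p : weights) : weights := (w111 p, w11b p, w11a p, w1ab p).

(* The product of a nonzero triple is invariant under permutation and, cubes
   being 1, under scaling: it is w on the orbit of (1, 1, w), w^2 on that of
   (1, 1, w^2), and 1 on the other two. *)
Definition qsum (p : weights) (x y z : quad) : bool :=
  let m := qmul x (qmul y z) in
  if m == qzero then z == qadd x y
  else if m == omega then w11a p
  else if m == omega2 then w11b p
  else if x == y then w111 p else w1ab p.

Definition weights_of (S : quad -> quad -> quad -> bool) : weights :=
  (S qone qone qone, S qone qone omega, S qone qone omega2,
   S qone omega omega2).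

Lemma weights_of_qsum p : weights_of (qsum p) = p.
Proof. by case: p => [[[]]]. Qed.

Lemma qsumC p x y z : qsum p x y z = qsum p y x z.
Proof. by case: x y z => [[] []] [[] []] [[] []]. Qed.

Lemma qsum_rot p x y z : qsum p y z x = qsum p x y z.
Proof. by case: x y z => [[] []] [[] []] [[] []]. Qed.

Lemma qsum0 p x y : qsum p qzero x y = (y == x).
Proof. by case: x y => [[] []] [[] []]. Qed.

Lemma qsum_eq0 p x y : qsum p x y qzero = (x == y).
Proof. by case: x y => [[] []] [[] []]. Qed.

Lemma qsum_scale p a x y z : a != qzero ->
  qsum p (qmul a x) (qmul a y) (qmul a z) = qsum p x y z.
Proof. by case: a x y z => [[] []] [[] []] [[] []] [[] []]. Qed.

Lemma qsum_frob p x y z :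
  qsum p (frob x) (frob y) (frob z) = qsum (swap p) x y z.
Proof. by case: x y z => [[] []] [[] []] [[] []]. Qed.

(** Scaling by the inverse of x reduces to triples starting with 1; permuting and rescaling these
    leads to a zero entry or to one of the four triples read off by [weights_of]. *)
Lemma eq_qsum (S : quad -> quad -> quad -> bool) :
    (forall x y z, S x y z = S y x z) ->
    (forall x y z, S y z x = S x y z) ->
    (forall x y, S qzero x y = (y == x)) ->
    (forall a x y z, a != qzero ->
      S (qmul a x) (qmul a y) (qmul a z) = S x y z) ->
  forall x y z, S x y z = qsum (weights_of S) x y z.
Proof.
move=> SC Srot S0 Sscale.
have Sr y z : S y z qzero = (z == y) by rewrite Srot S0.
have S_1 z : S qone z qone = S qone qone z by exact: Srot.
(* Scaling by w^2 turns (1, w, w) into (w^2, 1, 1), a rotation of (1, 1, w^2). *)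
have S_ww : S qone omega omega = S qone qone omega2.
  by rewrite -(Sscale omega2)//; exact/esym/Srot.
have S_w2w2 : S qone omega2 omega2 = S qone qone omega.
  by rewrite -(Sscale omega)//; exact/esym/Srot.
have S_w2w : S qone omega2 omega = S qone omega omega2.
  by rewrite -Srot SC Srot.
have S1 y z : S qone y z = qsum (weights_of S) qone y z.
  have: z \in quads by exact: mem_quads.
  have: y \in quads by exact: mem_quads.
  rewrite !inE => /or4P[] /eqP-> /or4P[] /eqP->;
    by rewrite ?Sr ?S_1 ?S_ww ?S_w2w2 ?S_w2w ?(SC qone qzero) ?S0.
move=> x y z; have [->|x0] := eqVneq x qzero; first by rewrite S0 qsum0.
have fx0 : frob x != qzero by apply: contra x0; case: x => [[] []].
have fxx : qmul (frob x) x = qone by case: x x0 {fx0} => [[] []].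
by rewrite -(Sscale _ x y z fx0) fxx S1 -(qsum_scale _ x y z fx0) fxx.
Qed.

(** Boolean quantifiers over [quads] make nonemptiness and associativity decidable by evaluation. *)
Definition admissible (p : weights) : bool :=
  all (fun x => all (fun y => has (qsum p x y) quads &&
    all (fun z => all (fun t =>
      has (fun u => qsum p y z u && qsum p x u t) quads
      == has (fun u => qsum p x y u && qsum p u z t) quads)
    quads) quads) quads) quads.

Lemma hasquadsP (P : pred quad) : reflect (exists x, P x) (has P quads).
Proof.
by apply: (iffP hasP) => [[x _]|[x]]; exists x => //; exact: mem_quads.
Qed.

Lemma allquadsP (P : pred quad) : reflect (forall x, P x) (all P quads).
Proof.
by apply: (iffP allP) => [h x|h x _]; last exact: h; exact/h/mem_quads.
Qed.

Lemma admissibleP p : reflect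
  ((forall x y, exists z, qsum p x y z) /\
   (forall x y z t, (exists2 u, qsum p y z u & qsum p x u t) <->
                    (exists2 u, qsum p x y u & qsum p u z t)))
  (admissible p).
Proof.
have has2P (P Q : pred quad) :
    (exists2 u, P u & Q u) <-> has (fun u => P u && Q u) quads.
  split=> [[u Pu Qu]|/hasquadsP[u /andP[]]]; last by exists u.
  by apply/hasquadsP; exists u; rewrite Pu.
apply: (iffP (allquadsP _)) => [h|[hn ha] x].
  split=> x y; have /allquadsP/(_ y)/andP[/hasquadsP// h1 /allquadsP h2] := h x.
  by move=> z t; have /allquadsP/(_ t)/eqP e := h2 z; rewrite !has2P e.
apply/allquadsP => y; apply/andP; split; first exact/hasquadsP.
apply/allquadsP => z; apply/allquadsP => t; apply/eqP; apply/idP/idP;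
  by move/has2P/ha/has2P.
Qed.

(** * The hyperfield attached to admissible weights *)

Section Model.
Variables (p : weights) (p_adm : admissible p).

Definition model_add (x y : quad) : set quad := [set z | qsum p x y z].

Lemma model_hyperring : is_hyperring qmul model_add qone qzero.
Proof.
have /admissibleP[add_neq0 addA] := p_adm.
have scale a x y : qmul a @` model_add x y = model_add (qmul a x) (qmul a y).
  apply/seteqP; have [->|a0] := eqVneq a qzero.
    split=> [_ [u _ <-]|z]; rewrite /model_add /= -/qzero qsum0 => // /eqP->.
    (* Multiplying a hypersum by 0 gives all of {0} because the hypersum is nonempty. *)
    by have [u] := add_neq0 x y; exists u.
  split=> [_ [z xyz <-]|z]; first by rewrite /model_add /= qsum_scale.
  rewrite /model_add /= -[z in qsum _ _ _ z](qmul_frobK z a0) qsum_scale//.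
  by exists (qmul (frob a) z) => //; exact: qmul_frobK.
split=> //; [exact: qmulA|exact: qmulC|exact: qmul1| |by case=> [[] []]|].
- split.
  + split=> [//|x y]; apply/seteqP; rewrite /model_add.
    by split=> z /=; rewrite qsumC.
  + move=> a b c; apply/seteqP; split=> t.
      by move=> /hyperadd_set1l/addA abc; apply/hyperadd_set1r.
    by move=> /hyperadd_set1r/addA abc; apply/hyperadd_set1l.
  + by move=> x; apply/seteqP; rewrite /model_add;
      split=> z /=; rewrite qsum0 => /eqP.
  + move=> x; exists x; rewrite /model_add /=.
    by split=> [|y]; rewrite qsum_eq0 => // /eqP.
  (* Each element is its own opposite, so reversibility is invariance under rotation. *)
  + move=> x y z y'; rewrite /model_add /= qsum_eq0 => /eqP <-.
    by rewrite qsum_rot.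
- move=> a x y; rewrite -!(qmulC a) -scale; congr (_ @` _).
  by apply/funext => u; exact: qmulC.
Qed.

Lemma qmul_inv x : x <> qzero -> exists y, qmul x y = qone.
Proof.
move=> /eqP x0; exists (qmul (frob x) qone); exact: qmul_frobK.
Qed.

Lemma qzero_neq_one : qzero <> qone. Proof. by []. Qed.

Definition model : hyperfield :=
  Hyperfield model_hyperring qzero_neq_one qmul_inv.

End Model.

(** * Multiplicative coordinates on a hyperfield of order 4 *)

Lemma card_quad : ([set: quad] #= `I_4)%card.
Proof.
apply/card_set_bijP; exists (index^~ quads); split.
- by move=> x _ /=; rewrite (index_mem x quads) mem_quads.
- by move=> x y _ _ /(congr1 (nth qzero quads)); rewrite !nth_index ?mem_quads.
- by move=> n n4; exists (nth qzero quads n); rewrite // index_uniq.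
Qed.

Lemma has_order4P (K : hyperfield) :
  has_order K 4 -> exists h : quad -> K, bijective h.
Proof.
move=> K4; have /card_set_bijP[g] : ([set: K] #= [set: quad])%card.
  exact: card_eq_trans K4 (card_esym card_quad).
by rewrite setTT_bijective => -[h gK hK]; exists h; exists g.
Qed.

(** Only 0, 1 and the product are matched with those of the field; the hyperaddition is the datum
    left to classify. *)
Record coordinates (K : hyperfield) (h : quad -> K) : Prop := {
  coord_bij : bijective h;
  coord0 : h qzero = hf_zero K;
  coord1 : h qone = hf_one K;
  coordM : forall x y, h (qmul x y) = hf_mul (h x) (h y)
}.

Lemma coordinates_frob (K : hyperfield) (h : quad -> K) :
  coordinates h -> coordinates (h \o frob).
Proof.
case=> h_bij h0 h1 hM; split=> //=; last by move=> x y; rewrite frobM hM.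
exact: (bij_comp h_bij (Bijective frobK frobK)).
Qed.

Section Classification.
Variable K : hyperfield.
Local Notation "0" := (hf_zero K).
Local Notation "1" := (hf_one K).
Local Notation "x * y" := (hf_mul x y).

Let ring := hf_hyperring K.

Lemma mulKC (x y : K) : x * y = y * x. Proof. exact: (hyperring_mulC ring). Qed.

Lemma mulK_inj (x y z : K) : x <> 0 -> x * y = x * z -> y = z.
Proof.
move=> /hf_inv[x' xx'] /(congr1 (hf_mul x')).
by rewrite !(hyperring_mulA ring) (mulKC x') xx' !(hyperring_mul1 ring).
Qed.

(** Any bijection respecting 0 and 1 is multiplicative: cancellation leaves one possible value for
    each product of the other two elements. *)
Lemma coordinatize : has_order K 4 -> exists h : quad -> K, coordinates h.
Proof.
move=> /has_order4P[h0 [g h0K gK]].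
have g01 : g 0 != g 1.
  by apply/eqP => /(can_inj gK); exact: hf_zero_neq_one.
(* The affine map of F_4 sending 0 to [g 0] and 1 to [g 1]. *)
pose s x := qadd (g 0) (qmul (qadd (g 0) (g 1)) x).
have s_bij : bijective s.
  exists (fun x => qmul (frob (qadd (g 0) (g 1))) (qadd (g 0) x));
    by rewrite /s; case: (g 0) (g 1) g01 => [[] []] [[] []]// _ [[] []].
pose h := h0 \o s.
have h_bij : bijective h by apply: bij_comp s_bij; exists g.
have h_inj := bij_inj h_bij.
have hz : h qzero = 0.
  by rewrite /h /= -[RHS]gK /s; case: (g 0) (g 1) => [[] []] [[] []].
have ho : h qone = 1.
  by rewrite /h /= -[RHS]gK /s; case: (g 0) (g 1) => [[] []] [[] []].
have mul0 x : 0 * x = 0 by exact: (hyperring_mul0l ring).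
have mul1 x : 1 * x = x by exact: (hyperring_mul1 ring).
have hn0 x : x != qzero -> h x <> 0.
  by move=> /eqP x0; rewrite -hz => /h_inj.
have ex_prod x y : x != qzero -> y != qzero -> x != qone -> y != qone ->
    exists t, [/\ h x * h y = h t, t != qzero, t != x & t != y].
  move=> x0 y0 x1 y1; have [k _ kK] := h_bij.
  exists (k (h x * h y)); rewrite kK; split=> //; apply/eqP.
  - move/(congr1 h); rewrite kK hz -(mul0 (h x)) (mulKC 0).
    by move/(mulK_inj (hn0 _ x0)); exact: hn0.
  - move/(congr1 h); rewrite kK -[X in _ = X]mul1 -ho (mulKC (h qone)).
    by move/(mulK_inj (hn0 _ x0))/h_inj/eqP; rewrite (negbTE y1).
  - move/(congr1 h); rewrite kK -[X in _ = X]mul1 -ho mulKC (mulKC (h qone)).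
    by move/(mulK_inj (hn0 _ y0))/h_inj/eqP; rewrite (negbTE x1).
have ab : h omega * h omega2 = h qone.
  by have [//|//|//|//|[[] []]] := ex_prod omega omega2; case.
have sqr x : x = omega \/ x = omega2 -> h x * h x = h (frob x).
  move=> xw; have x1 : x != qone by case: xw => ->.
  have x0 : x != qzero by case: xw => ->.
  have [t [e t0 tx _]] := ex_prod x x x0 x0 x1 x1; rewrite e; congr h.
  have : t != qone.
    (* A square equal to 1 would equal the product of x and [frob x], and cancelling x would give x
       = [frob x]. *)
    apply/eqP => t1; have : h x * h x = h x * h (frob x).
      by rewrite e t1 -ab; case: xw => -> //; exact: mulKC.
    by move=> /(mulK_inj (hn0 _ x0))/h_inj; case: xw => ->.
  by move: t0 tx; case: xw t {e} => -> [[] []].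
exists h; split=> // x y.
have: y \in quads by exact: mem_quads.
have: x \in quads by exact: mem_quads.
rewrite !inE => /or4P[] /eqP-> /or4P[] /eqP->;
  rewrite ?hz ?ho ?mul0 ?mul1 ?(mulKC _ 0) ?(mulKC _ 1) ?mul0 ?mul1
    ?(mulKC (h omega2)) ?ab ?sqr ?ho//; by [left|right].
Qed.

(** * The hyperaddition in coordinates *)

Let group := hyperring_hypergroup ring.

Lemma addKC (x y : K) : hf_add x y = hf_add y x.
Proof. exact: (hyperop_comm (hypergroup_hyperop group)). Qed.

Lemma addK_scale (a x y z : K) : a <> 0 ->
  hf_add (a * x) (a * y) (a * z) <-> hf_add x y z.
Proof.
move=> a0; rewrite -(hyperring_distrl ring); split; last by exists z.
by case=> u xyu /(mulK_inj a0) => <-.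
Qed.

Variable h : quad -> K.
Hypothesis h_coord : coordinates h.

Let h_inj : injective h. Proof. exact: bij_inj (coord_bij h_coord). Qed.

Lemma addK_opp (x y : K) : hf_add x y 0 <-> x = y.
Proof.
have opp_uniq (a b c : K) : hf_add a b 0 -> hf_add a c 0 -> b = c.
  by have [d [_ du]] := hypergroup_opp group a => /du <- /du.
have [y1 [y1P _]] := hypergroup_opp group 1.
have y10 : y1 <> 0.
  move=> e; move: y1P; rewrite e addKC (hypergroup_add0 group) /=.
  exact: hf_zero_neq_one.
(* Scaling 0 in 1 + y1 by y1 shows that y1 * y1 is an opposite of y1, and so is 1. *)
have y1y1 : y1 * y1 = 1.
  apply: (opp_uniq y1); last by rewrite addKC.
  rewrite -[X in hf_add X](hyperring_mul1 ring) mulKC.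
  by rewrite -[X in _ X](hyperring_mul0r ring y1) addK_scale.
(* Squaring is injective on the field, being the involution [frob]. *)
have y11 : y1 = 1.
  have [k _ kK] := coord_bij h_coord.
  move: y1y1; rewrite -(kK y1) -(coordM h_coord) -(coord1 h_coord).
  by move/h_inj => kk; congr h; rewrite -(frobK (k y1)) /frob kk.
(* Distributivity is used on images, which covers a = 0 as well. *)
have xx (a : K) : hf_add a a 0.
  have : (hf_mul a @` hf_add 1 1) 0.
    by exists 0; [rewrite -{2}y11|exact: (hyperring_mul0r ring)].
  by rewrite (hyperring_distrl ring) mulKC (hyperring_mul1 ring).
by split=> [xy|->]; [exact: opp_uniq (xx x) xy|exact: xx].
Qed.

Definition coord_sum (x y z : quad) : bool := `[< hf_add (h x) (h y) (h z) >].

Lemma coord_sumE x y z :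
  coord_sum x y z = qsum (weights_of coord_sum) x y z.
Proof.
apply: eq_qsum => {x y z}.
- by move=> x y z; rewrite /coord_sum addKC.
(* Since y is its own opposite, reversibility becomes rotation. *)
- move=> x y z; apply/asbool_equiv_eq.
  by apply: (hypergroup_rev group); rewrite addK_opp.
- move=> x y; rewrite /coord_sum (coord0 h_coord) (hypergroup_add0 group).
  by apply/asboolP/eqP => [/h_inj|->].
- move=> a x y z /eqP a0; apply/asbool_equiv_eq; rewrite !(coordM h_coord).
  by apply: addK_scale; rewrite -(coord0 h_coord) => /h_inj.
Qed.

Lemma coord_sum_admissible : admissible (weights_of coord_sum).
Proof.
have [k hk kh] := coord_bij h_coord.
apply/admissibleP; split=> [x y|x y z t].
  have [z xyz] := hyperop_neq0 (hypergroup_hyperop group) (h x) (h y).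
  by exists (k z); rewrite -coord_sumE; apply/asboolP; rewrite kh.
have assoc : hyperadd (@hf_add K) [set h x] (hf_add (h y) (h z)) (h t) <->
             hyperadd (@hf_add K) (hf_add (h x) (h y)) [set h z] (h t).
  by rewrite (hypergroup_assoc group).
split=> -[u]; rewrite -!coord_sumE => /asboolP yzu /asboolP xut.
  have /assoc/hyperadd_set1r[v] :
      hyperadd (@hf_add K) [set h x] (hf_add (h y) (h z)) (h t).
    by apply/hyperadd_set1l; exists (h u).
  by rewrite -(kh v) => xyv vzt; exists (k v); rewrite -coord_sumE;
    apply/asboolP.
have /assoc/hyperadd_set1l[v] :
    hyperadd (@hf_add K) (hf_add (h x) (h y)) [set h z] (h t).
  by apply/hyperadd_set1r; exists (h u).
by rewrite -(kh v) => yzv xvt; exists (k v); rewrite -coord_sumE;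
  apply/asboolP.
Qed.

Lemma coord_isomorphic p (p_adm : admissible p) :
  weights_of coord_sum = p -> hyperfield_isomorphic K (model p_adm).
Proof.
move=> pE; have [k hk kh] := coord_bij h_coord.
have sumE x y z : qsum p x y z <-> hf_add (h x) (h y) (h z).
  by rewrite -pE -coord_sumE; split=> /asboolP.
exists k, h; split=> //; split.
- by rewrite -(coord0 h_coord) hk.
- by rewrite -(coord1 h_coord) hk.
- by move=> x y; rewrite -{1}(kh x) -{1}(kh y) -(coordM h_coord) hk.
- by move=> x y _ [z xyz <-]; apply/sumE; rewrite !kh.
- exact: coord0 h_coord.
- exact: coord1 h_coord.
- exact: coordM h_coord.
- by move=> x y _ [z xyz <-]; apply/sumE.
Qed.

End Classification.

(** * Isomorphisms between models *)

Lemma weights_of_frob (K : hyperfield) (h : quad -> K) : coordinates h ->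
  weights_of (coord_sum (h \o frob)) = swap (weights_of (coord_sum h)).
Proof.
move=> h_coord; rewrite -[RHS]weights_of_qsum /weights_of.
by congr (_, _, _, _); rewrite -qsum_frob -coord_sumE.
Qed.

(** An isomorphism preserves membership in hypersums both ways. It is determined by the image of
    [omega], hence is the identity or [frob]. *)
Lemma model_isomorphic_weights p q
    (p_adm : admissible p) (q_adm : admissible q) :
  hyperfield_isomorphic (model p_adm) (model q_adm) -> p = q \/ p = swap q.
Proof.
move=> [f [g [[/= f0 f1 fM fD] [/= _ _ _ gD] fK gK]]].
have sumE x y z : qsum q (f x) (f y) (f z) = qsum p x y z.
  apply/idP/idP => [xyz|xyz]; last by apply: fD; exists z.
  by rewrite -(fK x) -(fK y) -(fK z); apply: gD; exists (f z).
have f_inj := can_inj fK.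
have fw2 : f omega2 = frob (f omega) by exact: (fM omega omega).
have : f omega = omega \/ f omega = omega2.
  have : f omega != qzero by rewrite -f0; apply/eqP => /f_inj.
  have : f omega != qone by rewrite -f1; apply/eqP => /f_inj.
  by case: (f omega) => [[] []]; [right| | left|].
case=> fw; [left|right]; rewrite -(weights_of_qsum p) /weights_of.
  rewrite -[RHS]weights_of_qsum /weights_of -!sumE.
  by rewrite fw2 fw [f _]f1.
rewrite -[RHS]weights_of_qsum /weights_of -!qsum_frob -!sumE.
by rewrite fw2 fw [f _]f1.
Qed.

(** If q and [swap q] both satisfy the implication, the two weights exchanged by [swap] agree, so
    [swap] fixes q. *)
Lemma normalized_eq p q : w11a p ==> w11b p -> w11a q ==> w11b q ->
  p = q \/ p = swap q -> p = q.
Proof.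
move=> np nq [//|pq]; move: np nq; rewrite pq.
by case: q {pq} => [[[? []] []] ?].
Qed.

(** * The seven classes *)

(* One representative of each [swap]-orbit of admissible weights, normalized
   by requiring 0 in 1 + 1 + w^2 whenever 0 is in 1 + 1 + w. *)
Definition representatives : seq weights :=
  [:: (false, false, false, true);
      (false, false, true, true);
      (false, true, true, false);
      (false, true, true, true);
      (true, false, true, true);
      (true, true, true, false);
      (true, true, true, true)].

(** Evaluating all sixteen weights shows that the list is complete. *)
Lemma mem_representatives p :
  (p \in representatives) = admissible p && (w11a p ==> w11b p).
Proof. by move: p => [[[[] []] []] []]; vm_compute. Qed.

(** The default of [nth] is never reached: the list has length 7. *)
Definition representative (i : 'I_7) : weights :=
  nth (false, false, false, false) representatives i.

Lemma representative_in i : representative i \in representatives.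
Proof. exact/mem_nth/ltn_ord. Qed.

Lemma representative_inj : injective representative.
Proof.
move=> i j /eqP; rewrite nth_uniq ?ltn_ord// => /eqP.
exact: val_inj.
Qed.

Lemma representative_admissible i : admissible (representative i).
Proof.
by have := representative_in i; rewrite mem_representatives => /andP[].
Qed.

Lemma representative_normalized i :
  w11a (representative i) ==> w11b (representative i).
Proof.
by have := representative_in i; rewrite mem_representatives => /andP[].
Qed.

Theorem proposition2p6 :
  exists F : 'I_7 -> hyperfield,
    [/\ forall i, has_order (F i) 4,
        forall i j, hyperfield_isomorphic (F i) (F j) -> i = j
      & forall K : hyperfield, has_order K 4 ->
          exists i, hyperfield_isomorphic K (F i)].
Proof.
exists (fun i => model (representative_admissible i)); split.
- by move=> i; exact: card_quad.
- move=> i j /model_isomorphic_weights ij; apply: representative_inj.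
  by apply: normalized_eq ij; exact: representative_normalized.
- move=> K /coordinatize[h h_coord].
  have [h' [h'_coord mem_h']] : exists h' : quad -> K,
      coordinates h' /\ weights_of (coord_sum h') \in representatives.
    have [norm|] := boolP (w11a (weights_of (coord_sum h)) ==>
                           w11b (weights_of (coord_sum h))).
      exists h; split=> //.
      by rewrite mem_representatives coord_sum_admissible.
    (* Here [w11a] is true and [w11b] false; after the swap [w11a] is false and the implication
       holds vacuously. *)
    rewrite negb_imply => /andP[wa wb]; exists (h \o frob).
    have hf_coord := coordinates_frob h_coord; split=> //.
    rewrite mem_representatives coord_sum_admissible//.
    by rewrite weights_of_frob// /w11a /= (negbTE wb).
  have i7 : index (weights_of (coord_sum h')) representatives < 7.
    by rewrite -[7]/(size representatives) index_mem.
  exists (Ordinal i7); apply: (coord_isomorphic h'_coord).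
  exact/esym/nth_index.
Qed.
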